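(* Let $d, m \in \mathbb{N}$ and let $K \in \mathcal{K}^d$ be a convex body such that $\mathcal{T}(K)$ is an $m$-fold tiling with at most four collision vectors. Then $\mathcal{T}(K)$ is a replication of a one-fold lattice tiling, i.e. there exists a sub-lattice $\Lambda$ of $\mathbb{Z}^d$ such that $\{K+z : z \in \Lambda\}$ is a one-fold tiling.
   Context: $\mathcal{K}^d$ is the family of convex bodies in $\mathbb{R}^d$ (compact convex sets with non-empty interior). For $A\subseteq\mathbb{R}^d$, $\mathcal{T}(A) := \{A+z : z \in \mathbb{Z}^d\}$. A family $\mathcal{T}$ of subsets of $\mathbb{R}^d$ is an $m$-fold packing if each $x \in \mathbb{R}^d$ lies in the interior of at most $m$ members of $\mathcal{T}$; an $m$-fold covering if each $x \in \mathbb{R}^d$ lies in at least $m$ members of $\mathcal{T}$; an $m$-fold tiling if it is both an $m$-fold packing and an $m$-fold covering. A vector $z \in \mathbb{Z}^d \setminus \{o\}$ ($o$ the origin) is a collision vector of $\mathcal{T}(K)$ if $\operatorname{int}(K) \cap (\operatorname{int}(K)+z) \neq \emptyset$. A lattice is a set $\{z_1u_1+\cdots+z_ku_k : z_1,\ldots,z_k\in\mathbb{Z}\}$ with $u_1,\ldots,u_k\in\mathbb{R}^d$ linearly independent; $k$ is its rank. If $\mathcal{T}(K)$ is an $m$-fold tiling and there is a sub-lattice $\Lambda$ of $\mathbb{Z}^d$ such that $\{K+z: z\in\Lambda\}$ is a one-fold tiling, then $\mathcal{T}(K)$ is called a replication of the one-fold tiling $\{K+z: z\in\Lambda\}$. 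*)

(* Defs.v *)
From mathcomp Require Import all_boot all_order all_algebra.
From mathcomp Require Import all_classical all_reals all_analysis.

Set Implicit Arguments.
Unset Strict Implicit.
Unset Printing Implicit Defensive.

Import Order.TTheory GRing.Theory Num.Theory.
Import numFieldNormedType.Exports.

Local Open Scope classical_set_scope.
Local Open Scope ring_scope.
Local Open Scope card_scope.

Definition convex_body (R : realType) (d : nat) (K : set 'rV[R]_d) : Prop :=
  [/\ compact K, convex_set K & interior K !=set0].

Definition integer_points (R : realType) (d : nat) : set 'rV[R]_d :=
  [set z | forall i, z ord0 i \is a Num.int].

Definition translate (R : realType) (d : nat) (A : set 'rV[R]_d)
    (z : 'rV[R]_d) : set 'rV[R]_d :=
  [set x + z | x in A].

(* A family of sets is a set of sets, so equal translates count once.  For the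
   bounded nonempty sets of interest, distinct vectors give distinct
   translates. *)
Definition translates (R : realType) (d : nat) (A : set 'rV[R]_d)
    (L : set 'rV[R]_d) : set (set 'rV[R]_d) :=
  [set translate A z | z in L].

Definition lattice_translates (R : realType) (d : nat) (A : set 'rV[R]_d) :
    set (set 'rV[R]_d) :=
  translates A (@integer_points R d).

(* [`I_m] is [set k | k < m], so comparing with it bounds a cardinal by m. *)
Definition fold_packing (R : realType) (d m : nat)
    (T : set (set 'rV[R]_d)) : Prop :=
  forall x, [set A | T A /\ interior A x] #<= `I_m.

Definition fold_covering (R : realType) (d m : nat)
    (T : set (set 'rV[R]_d)) : Prop :=
  forall x, `I_m #<= [set A | T A /\ A x].

Definition fold_tiling (R : realType) (d m : nat)
    (T : set (set 'rV[R]_d)) : Prop :=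
  fold_packing m T /\ fold_covering m T.

(* A collision vector z and its opposite -z are counted separately. *)
Definition collision_vectors (R : realType) (d : nat) (K : set 'rV[R]_d) :
    set 'rV[R]_d :=
  [set z | [/\ integer_points z, z != 0 &
               interior K `&` translate (interior K) z !=set0]].

(* The rank k may be smaller than d. *)
Definition is_lattice (R : realType) (d : nat) (L : set 'rV[R]_d) : Prop :=
  exists k (u : k.-tuple 'rV[R]_d),
    free u /\
    L = [set \sum_(i < k) tnth u i *~ z i | z in [set: 'I_k -> int]].

(* Main.v *)
Require Import Defs.
From mathcomp Require Import all_boot all_order all_algebra.
From mathcomp Require Import all_classical all_reals all_analysis.
From mathcomp Require Import lra zify.

(* Let S be the set of collision vectors.  If a sublattice L of index n, given
   as the kernel of a linear form modulo n, avoids S, then integer translates of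
   int K sharing a point lie in distinct cosets of L.  A generic point lies in
   exactly m translates, all through their interiors, so m <= n; and if m = n
   these translates meet every coset, so K + L is dense, hence everything, and
   {K + z : z in L} is a one-fold tiling.

   If w and 2w are both in S, then S = {w, -w, 2w, -2w}, and m >= 3 because the
   translates by 0, w, 2w have a common interior point.  Convexity forbids w in
   3 Z^d, so some coordinate modulo 3 avoids S.  Otherwise S lies in
   {a, -a, b, -b} with a, b not in 2 Z^d, so a coordinate, or the sum of two
   coordinates, is odd on both, and m <= 2; for m = 1 take L = Z^d. *)

Set Implicit Arguments.
Unset Strict Implicit.
Unset Printing Implicit Defensive.

Import Order.TTheory GRing.Theory Num.Theory.
Import numFieldNormedType.Exports.
Local Open Scope classical_set_scope.
Local Open Scope ring_scope.
Local Open Scope card_scope.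

(** * Cardinal bounds expressed through duplicate-free lists *)

Lemma II_card_leP (T : choiceType) (A : set T) (m : nat) : `I_m #<= A <->
  exists s : seq T, [/\ uniq s, size s = m & forall x, x \in s -> A x].
Proof.
split=> [/card_leP[f]|[s [us <- sA]]].
  pose g (i : 'I_m) := set_val (f (SigSub (mem_set (ltn_ord i : `I_m i)))).
  exists [seq g i | i <- enum 'I_m]; split.
  - rewrite map_inj_uniq ?enum_uniq // => i j gij; apply: val_inj.
    have fij := val_inj gij.
    by have /(congr1 set_val) := inj (in_setT _) (in_setT _) fij.
  - by rewrite size_map size_enum_ord.
  - by move=> x /mapP[i _ ->]; apply/set_mem/valP.
(* The empty list is split off because [nth] needs a default element; otherwise the head serves as
   one. *)
case: s us sA => [|x0 s'] us sA; first by rewrite II0 card_ge0.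
set s := x0 :: s' in us sA *.
have nthinj : {in `I_(size s) &, injective (nth x0 s)}.
  by move=> i j; rewrite !inE => il jl /eqP; rewrite nth_uniq // => /eqP.
rewrite -(card_le_eql (inj_card_eq nthinj)).
by apply: subset_card_le => _ [i /= il <-]; exact/sA/mem_nth.
Qed.

Lemma card_le_II_uniq (T : choiceType) (A : set T) (m : nat) (s : seq T) :
  A #<= `I_m -> uniq s -> (forall x, x \in s -> A x) -> (size s <= m)%N.
Proof.
move=> Am us sA; have : `I_(size s) #<= A by apply/II_card_leP; exists s.
by move=> /card_le_trans /(_ Am); rewrite card_le_II.
Qed.

(** * Interiors of convex sets *)

Section convex.
Variables (R : realType) (V : normedModType R).
Implicit Types (A : set V) (p q : V).

Lemma interior_ballP A p :
  A° p <-> exists2 e : R, 0 < e & forall y, `|y| < e -> A (p + y).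
Proof.
split=> [/nbhs_ballP[e e0 eA]|[e e0 eA]].
  exists e => // y ye; apply: eA; rewrite -ball_normE /=.
  by rewrite opprD addNKr normrN.
apply/nbhs_ballP; exists e => // y; rewrite -ball_normE /= => ye.
by rewrite -[y](subrKC p); apply: eA; rewrite distrC.
Qed.

Lemma interior_shift A z p : (fun x => A (x - z))° p <-> A° (p - z).
Proof.
by split=> /interior_ballP[e e0 eA]; apply/interior_ballP; exists e => // y ye;
  have := eA y ye; rewrite addrAC.
Qed.

Lemma convex_setP A p q (t : R) : convex_set A -> A p -> A q ->
  0 <= t -> t <= 1 -> A (p + t *: (q - p)).
Proof.
move=> cA Ap Aq t0 t1.
have := cA q p (Itv01 t0 t1) (mem_set Aq) (mem_set Ap).
rewrite inE; congr (A _); rewrite /conv /= /unstable.onem.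
rewrite scalerBr scalerBl scale1r addrC -addrA; congr (_ + _).
by rewrite addrC.
Qed.

(** Contracting towards [p] by the factor [t] maps the [e]-ball about [q] to a [t * e]-ball about
    the new point, and convexity keeps the image inside [A]. *)
Lemma convex_interior_segment A p q (t : R) : convex_set A -> A p -> A° q ->
  0 < t -> t <= 1 -> A° (p + t *: (q - p)).
Proof.
move=> cA Ap /interior_ballP[e e0 eA] t0 t1; apply/interior_ballP.
exists (t * e) => [|y yte]; first exact: mulr_gt0.
have := @convex_setP A p (q + t^-1 *: y) t cA Ap _ (ltW t0) t1.
rewrite addrAC scalerDr scalerA divff ?gt_eqF // scale1r addrA; apply.
apply: eA; rewrite normrZ gtr0_norm ?invr_gt0 //.
by rewrite mulrC ltr_pdivrMr // mulrC.
Qed.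

Lemma convex_subset_closure_interior A : convex_set A -> A° !=set0 ->
  A `<=` closure A°.
Proof.
move=> cA [q Aq] p Ap U /nbhs_ballP[e e0 eU].
(* The [+ 1] keeps [N] positive even if [q = p]; the choice of [t] then gives
   [t * |q - p| <= e / 2 < e]. *)
pose N := `|q - p| + 1; have N0 : 0 < N by rewrite ltr_wpDl.
pose t := Num.min 1 (e / 2 / N).
have t0 : 0 < t by rewrite lt_min ltr01 !divr_gt0.
exists (p + t *: (q - p)); split.
  by apply: convex_interior_segment => //; rewrite ge_min lexx.
apply: eU; rewrite -ball_normE /= opprD addNKr normrN normrZ gtr0_norm //.
apply: (@le_lt_trans _ _ (t * N)); first by rewrite ler_wpM2l ?ltW // ltrDl.
apply: (@le_lt_trans _ _ (e / 2)); last by rewrite ltr_pdivrMr // ltr_pMr //; lra.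
by rewrite -ler_pdivlMr // ge_min lexx orbT.
Qed.

End convex.

(** * Translates and integer vectors *)

Section translates.
Variables (R : realType) (d : nat).
Implicit Types (A : set 'rV[R]_d) (x z : 'rV[R]_d) (w : 'rV[int]_d).

Lemma translateE A z x : translate A z x <-> A (x - z).
Proof.
split=> [[y Ay <-]|Axz]; first by rewrite addrK.
by exists (x - z) => //; rewrite subrK.
Qed.

Lemma interior_translate A z x : (translate A z)° x <-> A° (x - z).
Proof.
have -> : translate A z = fun y => A (y - z); last exact: interior_shift.
by apply/funext => y; apply/propext/translateE.
Qed.

(** Equal translates make [A] invariant under the shift [z - z'], and iterating a nonzero shift
    leaves every bounded set. Hence members of a family of translates can be counted by their
    vectors. *)
Lemma translate_inj A : bounded_set A -> A !=set0 -> injective (translate A).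
Proof.
move=> [M [_ MA]] [p Ap] z z' zz'; apply/eqP; rewrite -subr_eq0.
have Ashift q : A q -> A (q + (z - z')).
  move=> Aq; have : translate A z (q + z) by apply/translateE; rewrite addrK.
  by rewrite zz' => /translateE; rewrite -addrA.
have Aiter n : A (p + (z - z') *+ n).
  by elim: n => [|n /Ashift]; rewrite ?addr0 // -addrA -mulrSr.
apply: contraT; rewrite -normr_gt0 => zz'0.
have Anorm q : A q -> `|q| <= M + 1 by apply: MA; rewrite ltrDl.
(* The Archimedean property yields [n] with [n * |z - z'| > M + 1 + |p|], so the [n]-th iterate is
   out of bounds. *)
have := archi_boundP (divr_ge0 (addr_ge0 (le_trans (normr_ge0 p) (Anorm p Ap))
  (normr_ge0 p)) (ltW zz'0)).
rewrite ltr_pdivrMr // mulr_natl -normrMn ltNge => /negP; case.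
rewrite -[_ *+ _](addKr p) (le_trans (ler_normD _ _)) //.
by rewrite normrN addrC lerD2r Anorm.
Qed.

Definition int_row w : 'rV[R]_d := map_mx intr w.

Lemma int_row0 : int_row 0 = 0. Proof. exact: map_mx0. Qed.
Lemma int_rowD w w' : int_row (w + w') = int_row w + int_row w'.
Proof. exact: map_mxD. Qed.
Lemma int_rowB w w' : int_row (w - w') = int_row w - int_row w'.
Proof. exact: map_mxB. Qed.
Lemma int_rowMn w n : int_row (w *+ n) = int_row w *+ n.
Proof. by elim: n => [|n IH]; rewrite ?int_row0 // !mulrS int_rowD IH. Qed.

Lemma int_row_inj : injective int_row.
Proof.
move=> w w' /rowP ww'; apply/rowP => i.
by have := ww' i; rewrite !mxE => /intr_inj.
Qed.

Lemma integer_pointsP z : integer_points z <-> exists w, z = int_row w.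
Proof.
split=> [zint|[w ->] i]; last by rewrite mxE intr_int.
exists (\row_i Num.floor (z ord0 i)); apply/rowP => i; rewrite !mxE.
by apply/esym/eqP; rewrite -intrEfloor.
Qed.

End translates.

(** * Generic points and local finiteness *)

Lemma filter_all_seq (T : Type) (I : eqType) (F : set_system T) (s : seq I)
    (P : I -> T -> Prop) : Filter F ->
  (forall i, i \in s -> \forall x \near F, P i x) ->
  \forall x \near F, forall i, i \in s -> P i x.
Proof.
move=> FF; elim: s => [_|i s IH Ps]; first exact: nearW.
have Pi : \forall x \near F, P i x by apply: Ps; rewrite mem_head.
have Ps' : \forall x \near F, forall j, j \in s -> P j x.
  by apply: IH => j js; apply: Ps; rewrite inE js orbT.
near=> x => j; rewrite inE => /orP[/eqP->|]; first by near: x.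
by move: j; near: x.
Unshelve. all: by end_near. Qed.

Lemma int_row_bounded_seq d (N : nat) :
  exists s : seq 'rV[int]_d, forall w : 'rV[int]_d,
    (forall i, `|w 0%R i|%N <= N)%N -> w \in s.
Proof.
(* Adding [N] moves coordinates from [[-N, N]] to [[0, 2N]], so the box is indexed by a finite
   function type. *)
exists [seq \row_i ((f i)%:Z - N%:Z) | f : {ffun 'I_d -> 'I_(N + N).+1}] => w wN.
apply/fintype.imageP; exists [ffun i => inord `|(w 0 i + N%:Z)%R|%N] => //.
apply/rowP => i; rewrite !mxE ffunE; move: (w 0 i) (wN i) => z zN.
by rewrite inordK; lia.
Qed.

Lemma ler_coord_norm (R : realType) d (x : 'rV[R]_d) i : `|x 0 i| <= `|x|.
Proof.
rewrite [leRHS]/Num.Def.normr /= mx_normrE; apply/bigmax_geP; right => /=.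
by exists (0, i).
Qed.

Section generic.
Variables (R : realType) (d m : nat) (K : set 'rV[R]_d).
Hypothesis hK : convex_body K.
Local Notation ι := (@int_row R d).

Let bK : bounded_set K. Proof. by case: hK => /compact_bounded. Qed.

Lemma near_interior_shift (z x : 'rV[R]_d) : K° (x - z) -> \forall y \near x, K° (y - z).
Proof.
move=> /(interior_shift K z x).2 /nbhs_interior; apply: filterS => y.
exact: (interior_shift K z y).1.
Qed.

Lemma lattice_packing_size x (s : seq 'rV[int]_d) :
  fold_packing m (lattice_translates K) -> uniq s ->
  (forall w, w \in s -> K° (x - ι w)) -> (size s <= m)%N.
Proof.
move=> /(_ x) pK us sK.
have tinj : injective (translate K).
  by apply: translate_inj => //; case: hK => _ _ [p /interior_subset]; exists p.
rewrite -(size_map (translate K \o ι)); apply: card_le_II_uniq pK _ _.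
  by rewrite map_inj_uniq // => w w' /tinj /int_row_inj.
move=> _ /mapP[w ws ->]; split; last by apply/interior_translate/sK.
by exists (ι w) => //; apply/integer_pointsP; exists w.
Qed.

Lemma lattice_covering_seq x : fold_covering m (lattice_translates K) ->
  exists s : seq 'rV[int]_d,
    [/\ uniq s, size s = m & forall w, w \in s -> K (x - ι w)].
Proof.
move=> /(_ x) /II_card_leP [s [us <- sK]].
(* The default [0] is never taken on [s]: every member of [s] is an integer translate. *)
pose g A : 'rV[int]_d := xget 0 [set w | translate K (ι w) = A].
have gK : {in s, cancel g (translate K \o ι)}.
  move=> A /sK[[z /integer_pointsP[w ->] <-] _].
  by rewrite /g /=; case: xgetP => [v _ //|/(_ w)[]].
exists (map g s); rewrite size_map; split => //.
  by rewrite map_inj_in_uniq //; apply: can_in_inj gK.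
move=> _ /mapP[A As ->]; apply/translateE.
by have /= -> := gK A As; case: (sK A As).
Qed.

(* A point of U lying in the interiors of as many translates as possible lies on
   no boundary: near a boundary point of K + w, some point of int K + w would
   still lie in all the previous interiors. *)
Lemma generic_interior_covering (x : 'rV[R]_d) (U : set 'rV[R]_d) :
  fold_tiling m (lattice_translates K) -> nbhs x U -> exists y (s : seq 'rV[int]_d),
    [/\ U y, uniq s, size s = m & forall w, w \in s -> K° (y - ι w)].
Proof.
move=> [pK cK] xU.
pose P k := exists y (s : seq 'rV[int]_d),
  [/\ U° y, uniq s, size s = k & forall w, w \in s -> K° (y - ι w)].
have exP : exists k, `[< P k >].
  by exists 0%N; apply/asboolP; exists x, [::]; split.
have ubP k : `[< P k >] -> (k <= m)%N.
  by move=> /asboolP[y [s [_ us <-]]]; apply: lattice_packing_size.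
case: (ex_maxnP exP ubP) => k /asboolP[y [s [Uy us <- sK]]] kmax.
have [t [ut tm tK]] := lattice_covering_seq y cK.
exists y, t; split => //; first exact: interior_subset.
move=> w wt; apply: contrapT => nKw.
have ws : w \notin s by apply/negP => /sK.
pose V := U° `&` [set y' | forall w, w \in s -> K° (y' - ι w)].
have yV : nbhs y V.
  apply: filterI; first exact: nbhs_interior.
  apply: (@filter_all_seq _ _ (nbhs y) s (fun w y' => K° (y' - ι w)) _) => v vs.
  exact/near_interior_shift/sK.
have [_ cvK iK] := hK.
have yVw : nbhs (y - ι w) (fun v => V (v - - ι w)).
  by apply: (interior_shift V _ _).2; rewrite opprK subrK.
have [v [Kv]] := convex_subset_closure_interior cvK iK (tK _ wt) yVw.
rewrite opprK => -[Uv sv].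
suff /asboolP/kmax : P (size s).+1 by rewrite ltnn.
exists (v + ι w), (w :: s); split => //=; first by rewrite ws.
by move=> w'; rewrite inE => /orP[/eqP->|/sv//]; rewrite addrK.
Qed.

(** Since [K] is bounded, only finitely many [K + w] meet the unit ball about [x]; each is closed,
    so a point outside all of them has a neighbourhood missing the union. *)
Lemma translates_closed (L : set 'rV[int]_d) :
  closed [set x | exists2 w, L w & K (x - ι w)].
Proof.
move=> x clx; apply: contrapT => nKx.
have [M [_ /(_ (M + 1))]] := bK; rewrite ltrDl ltr01 => /(_ isT) MK.
(* If [y] is within 1 of [x] and [y - w] is in [K], then [|w| <= |x| + 1 + (M + 1)]. The norm is the
   sup norm, so this bounds each coordinate of [w]. *)
have [s sP] := int_row_bounded_seq d (Num.bound (`|x| + 1 + (M + 1))).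
pose V := ball x 1 `&` [set y | forall w, w \in s -> L w -> ~ K (y - ι w)].
have xV : nbhs x V.
  apply: filterI; first exact: nbhsx_ballx.
  apply: (@filter_all_seq _ _ (nbhs x) s (fun w y => L w -> ~ K (y - ι w)) _) => w _.
  have [Lw|nLw] := pselect (L w); last exact: nearW.
  have oK : open (~` K).
    by apply: closed_openC; apply: compact_closed => //; case: hK.
  have : nbhs (x - ι w) (~` K).
    by apply: open_nbhs_nbhs; split=> // Kxw; apply: nKx; exists w.
  by move=> /(interior_shift _ _ _).2; apply: filterS => y nKy _; exact: nKy.
have [y [[w Lw Kyw] [xy ws]]] := clx V xV.
apply: (ws w) => //; apply: sP => i.
set B := `|x| + 1 + (M + 1).
have wB : `|ι w| <= B.
  have -> : ι w = x - (x - y) - (y - ι w) by rewrite subKr subKr.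
  apply: (le_trans (ler_normB _ _)); apply: lerD; last exact: MK.
  apply: (le_trans (ler_normB _ _)); rewrite lerD2l ltW //.
  by move: xy; rewrite -ball_normE.
have wiB : `|(w 0 i)%:~R : R| <= B.
  by apply: le_trans wB; have := ler_coord_norm (ι w) i; rewrite mxE.
have := ltW (le_lt_trans wiB (archi_boundP (le_trans (normr_ge0 _) wB))).
by rewrite -intr_norm -abszE pmulrn ler_nat.
Qed.
End generic.

(** * Sublattices defined by a linear form modulo [n] *)

Section sublattice.
Variable d : nat.
Implicit Types (a : 'I_d -> int) (w : 'rV[int]_d) (n : nat).

Definition dot a w : int := \sum_i a i * w 0 i.

Lemma dotB a w w' : dot a (w - w') = dot a w - dot a w'.
Proof.
by rewrite /dot -sumrB; apply: eq_bigr => i _; rewrite !mxE mulrBr.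
Qed.

Lemma dot_delta j w : dot (fun i => (i == j)%:R) w = w 0 j.
Proof.
rewrite /dot (bigD1 j) //= eqxx mul1r big1 ?addr0 // => i /negPf ->.
by rewrite mul0r.
Qed.

Lemma dot_deltaD j k w :
  dot (fun i => (i == j)%:R + (i == k)%:R) w = w 0 j + w 0 k.
Proof.
rewrite -!dot_delta /dot -big_split /=; apply: eq_bigr => i _.
exact: mulrDl.
Qed.

Definition ker_mod a n : set 'rV[int]_d := [set w | (n %| dot a w)%Z].

(** When [a j = 1], correcting each other unit vector by a multiple of the [j]-th puts it in the
    kernel of the form; [n] times the [j]-th unit vector completes a basis of [ker_mod a n]. *)
Definition ker_mod_basis a n j (i : 'I_d) : 'rV[int]_d :=
  if i == j then n%:Z *: delta_mx 0 j else delta_mx 0 i - a i *: delta_mx 0 j.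

(** The ring is arbitrary because freeness needs real coefficients and spanning needs integer
    ones. *)
Lemma ker_mod_basis_comb (T : comNzRingType) a n j (k : 'I_d -> T) l :
  \sum_i k i * (ker_mod_basis a n j i 0 l)%:~R =
  if l == j then n%:R * k j - \sum_(i | i != j) (a i)%:~R * k i else k l.
Proof.
rewrite /ker_mod_basis; case: eqVneq => [->|lj].
  rewrite (bigD1 j) //= eqxx !mxE !eqxx mulr1 mulrC; congr (_ + _).
  rewrite -sumrN; apply: eq_bigr => i ij; rewrite (negPf ij) !mxE !eqxx /=.
  by rewrite eq_sym (negPf ij) mulr1 sub0r rmorphN mulrN mulrC.
rewrite (bigD1 l) //= (negPf lj) !mxE !eqxx (negPf lj) /= mulr0 subr0 mulr1.
rewrite big1 ?addr0 // => i il; case: ifP => _; rewrite !mxE.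
  by rewrite (negPf lj) /= mulr0 mulr0.
by rewrite eq_sym (negPf il) (negPf lj) /= mulr0 subr0 mulr0.
Qed.

Lemma is_lattice_ker_mod (R : realType) a n j : a j = 1 -> (0 < n)%N ->
  is_lattice (@int_row R d @` ker_mod a n).
Proof.
move=> aj n0; pose b := ker_mod_basis a n j.
pose u : d.-tuple 'rV[R]_d := [tuple int_row R (b i) | i < d].
exists d, u; split.
  apply/freeP => k /rowP k0.
  have kl l : \sum_i k i * (b i 0 l)%:~R = 0.
    have := k0 l; rewrite mxE summxE => kl0; rewrite -[RHS]kl0; apply: eq_bigr => i _.
    by rewrite (nth_map i) ?size_enum_ord // nth_ord_enum !mxE.
  have kne l : l != j -> k l = 0.
    by move=> lj; have := kl l; rewrite ker_mod_basis_comb (negPf lj).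
  move=> i; have [->|/kne//] := eqVneq i j.
  have := kl j; rewrite ker_mod_basis_comb eqxx big1 => [|l /kne ->]; last first.
    by rewrite mulr0.
  by rewrite subr0 => /eqP; rewrite mulf_eq0 pnatr_eq0 gtn_eqF //= => /eqP.
have sumE (z : 'I_d -> int) w :
    \sum_(i < d) tnth u i *~ z i = int_row R w <->
    forall l, w 0 l = \sum_i z i * (b i 0 l)%:~R.
  have sum_coord l : (\sum_(i < d) tnth u i *~ z i) 0 l =
      (\sum_i z i * (b i 0 l)%:~R)%:~R :> R.
    rewrite summxE rmorph_sum; apply: eq_bigr => i _.
    by rewrite tnth_mktuple -scaler_int !mxE intz rmorphM.
  split=> [/rowP zw l|wl].
    by have := zw l; rewrite sum_coord mxE => /intr_inj.
  by apply/rowP => l; rewrite sum_coord mxE wl.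
apply/seteqP; split=> [_ [w /dvdzP[q wq] <-]|_ [z _ <-]].
  (* Off [j] the coefficients must be the coordinates of [w]; at [j], the quotient [q = dot a w / n]
     restores the right coordinate because [a j = 1]. *)
  exists (fun i => if i == j then q else w 0 i) => //; apply/sumE => l.
  rewrite ker_mod_basis_comb eqxx; case: eqVneq => [->|//].
  rewrite mulrC natz -wq /dot (bigD1 j) //= aj mul1r -addrA.
  rewrite [X in _ + X](_ : _ = 0) ?addr0 //; apply/eqP; rewrite subr_eq0.
  by apply/eqP; apply: eq_bigr => i /negPf ->; rewrite intz.
exists (\row_l \sum_i z i * (b i 0 l)%:~R); last first.
  by apply/esym/sumE => l; rewrite mxE.
rewrite /ker_mod /= /dot (bigD1 j) //= aj mul1r mxE ker_mod_basis_comb eqxx.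
rewrite -addrA [X in _ + X]addrC.
have -> : \sum_(i | i != j) a i * (\row_l \sum_i z i * (b i 0 l)%:~R) 0 i =
   \sum_(i | i != j) (a i)%:~R * z i.
  apply: eq_bigr => i ij; rewrite mxE ker_mod_basis_comb (negPf ij).
  by rewrite intz.
by rewrite subrr addr0 natz dvdz_mulr.
Qed.

End sublattice.

(** For positive dimension this is the kernel modulo 1 of a coordinate. Dimension 0 has no
    coordinate to use and gets the empty basis. *)
Lemma is_lattice_integer_points (R : realType) d :
  is_lattice (@integer_points R d).
Proof.
case: d => [|d].
  exists 0%N, [tuple]; split; first exact: nil_free.
  apply/seteqP; split=> [x _|_ [z _ <-] []//].
  by exists (fun=> 0) => //; rewrite big_ord0 [x]thinmx0.
have -> : @integer_points R d.+1 =
    @int_row R d.+1 @` ker_mod (fun i => (i == ord0)%:R) 1.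
  apply/seteqP; split=> [x /integer_pointsP[w ->]|_ [w _ <-]].
    by exists w => //; rewrite /ker_mod /= dvd1z.
  by apply/integer_pointsP; exists w.
exact: (is_lattice_ker_mod R (j := ord0)).
Qed.

(** * Tilings from collision-free sublattices *)

Section tiling.
Variables (R : realType) (d m : nat) (K : set 'rV[R]_d).
Hypothesis hK : convex_body K.
Hypothesis htiling : fold_tiling m (lattice_translates K).
Local Notation ι := (@int_row R d).

Definition collides (w : 'rV[int]_d) := exists2 x, K° x & K° (x - ι w).

Definition collision_free (L : set 'rV[int]_d) :=
  forall w, w != 0 -> L w -> ~ collides w.

Lemma collidesP w : w != 0 -> collides w -> collision_vectors K (ι w).
Proof.
move=> w0 [x Kx Kxw]; split.
- by apply/integer_pointsP; exists w.
- by rewrite -(int_row0 R) (inj_eq (@int_row_inj R d)).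
- by exists x; split=> //; apply/translateE.
Qed.

Lemma collidesN w : collides w -> collides (- w).
Proof.
move=> [x Kx Kxw]; exists (x - ι w); first exact: Kxw.
by rewrite -[- w]sub0r int_rowB int_row0 sub0r opprK subrK.
Qed.

(** The point [x - w] lies on the segment from [x] to [x - (n + 1) w], at the fraction
    [1 / (n + 1)]. Thus if a multiple of [w] collides, so does [w]. *)
Lemma interior_between x w n : K° x -> K° (x - ι (w *+ n.+1)) -> K° (x - ι w).
Proof.
move=> Kx Kxw; case: hK => _ cK _.
have n0 : 0 < n.+1%:R^-1 :> R by rewrite invr_gt0.
have n1 : n.+1%:R^-1 <= 1 :> R by rewrite invf_le1 // ler1n.
have := convex_interior_segment cK (interior_subset Kx) Kxw n0 n1.
rewrite [x - _ - x]addrAC subrr sub0r scalerN int_rowMn -[ι w *+ _]scaler_nat scalerA.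
by rewrite mulVf ?scale1r // pnatr_eq0.
Qed.

Definition residue a n (w : 'rV[int]_d) : nat := `|(dot a w %% n)%Z|%N.

(** Vectors whose translates of the interior share [y] differ by a colliding vector, while equal
    residues would put the difference in the kernel. *)
Lemma residue_injective a n y (s : seq 'rV[int]_d) : (0 < n)%N ->
  collision_free (ker_mod a n) -> (forall w, w \in s -> K° (y - ι w)) ->
  {in s &, injective (residue a n)}.
Proof.
move=> n0 Sn sK w w' ws w's ww'; apply/eqP; rewrite -subr_eq0.
apply/negP => /negP ww'0; apply: (Sn _ ww'0); last first.
  exists (y - ι w'); first exact: sK.
  by rewrite int_rowB opprB addrA subrK; exact: sK.
have n0' : n%:Z != 0 by lia.
rewrite /ker_mod /= dotB -eqz_mod_dvd.
by apply/eqP; move: ww'; rewrite /residue => /(congr1 Posz);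
  rewrite !gez0_abs ?modz_ge0.
Qed.

Lemma residue_lt a n w : (0 < n)%N -> (residue a n w < n)%N.
Proof.
move=> n0; have := ltz_pmod (dot a w) (n0 : 0 < n%:Z).
have := @modz_ge0 (dot a w) n%:Z; rewrite /residue; lia.
Qed.

Section kernel.
Variables (a : 'I_d -> int) (n : nat).
Hypotheses (n0 : (0 < n)%N) (Sn : collision_free (ker_mod a n)).

Let residue_sub s : {subset map (residue a n) s <= iota 0 n}.
Proof.
by move=> _ /mapP[w _ ->]; rewrite mem_iota add0n residue_lt.
Qed.

Lemma multiplicity_le_index : (m <= n)%N.
Proof.
have nbhs0T : nbhs (0 : 'rV[R]_d) setT by apply: filterT.
have [y [s [_ us <- sK]]] := generic_interior_covering hK htiling nbhs0T.
rewrite -(size_map (residue a n)) -[leqRHS](size_iota 0).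
apply: uniq_leq_size => //.
by rewrite map_inj_in_uniq //; exact: (residue_injective n0 Sn sK).
Qed.

(** Packing holds because two overlapping members would differ by a collision vector in the kernel.
    For covering, points covered by the kernel translates are dense, and their union is closed. *)
Lemma ker_mod_tiling : m = n -> fold_tiling 1 (translates K (ι @` ker_mod a n)).
Proof.
move=> mn; split=> x.
  have [->|/set0P[_ [[_ [w Lw <-] <-] /interior_translate Kxw]]] :=
    eqVneq [set A | translates K (ι @` ker_mod a n) A /\ A° x] set0.
    exact: card_ge0.
  rewrite -(card_le_eqr (@card_set1 _ (translate K (ι w)))).
  apply: subset_card_le => _ [[_ [v Lv <-] <-] /interior_translate Kxv] /=.
  congr (translate K (ι _)); apply/eqP; rewrite -subr_eq0.
  apply/negP => /negP wv0; apply: (Sn wv0).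
    by rewrite /ker_mod /= dotB rpredB.
  exists (x - ι w); first exact: Kxw.
  by rewrite int_rowB opprB addrA subrK.
have [w Lw Kxw] : exists2 w, ker_mod a n w & K (x - ι w).
  apply: (translates_closed hK) => U xU.
  have [y [s [Uy us sm sK]]] := generic_interior_covering hK htiling xU.
  have ur : uniq (map (residue a n) s).
    by rewrite map_inj_in_uniq //; exact: (residue_injective n0 Sn sK).
  have nr : (size (iota 0 n) <= size (map (residue a n) s))%N.
    by rewrite size_map size_iota sm mn.
  (* The [m = n] distinct residues fill [0, ..., n - 1]; the vector with residue 0 lies in the
     kernel. *)
  have [_ /(_ 0%N)] := uniq_min_size ur (@residue_sub s) nr.
  rewrite mem_iota add0n n0 => /mapP[w ws w0].
  exists y; split=> //; exists w; last exact: (interior_subset (sK w ws)).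
  by apply/dvdz_mod0P/eqP; rewrite -absz_eq0 -/(residue a n w) -w0.
apply/II_card_leP; exists [:: translate K (ι w)]; split=> // A.
rewrite inE => /eqP ->; split; last exact/translateE.
by exists (ι w) => //; exists w.
Qed.

End kernel.

Definition has_lattice_tiling := exists L : set 'rV[R]_d,
  [/\ is_lattice L, L `<=` @integer_points R d & fold_tiling 1 (translates K L)].

Lemma one_fold_tiling_integer_points : m = 1%N -> has_lattice_tiling.
Proof.
move=> m1; exists (@integer_points R d); split => //.
  exact: is_lattice_integer_points.
by rewrite -m1; exact: htiling.
Qed.

End tiling.

(** * Counting collision vectors and divisibility of coordinates *)

Lemma multiplicity_gt0 (R : realType) (d m : nat)
  (K : set 'rV[R]_d) : convex_body K -> fold_packing m (lattice_translates K) ->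
  (0 < m)%N.
Proof.
move=> hK pK; have [_ _ [p Kp]] := hK.
apply: (@lattice_packing_size _ _ _ _ hK p [:: 0] pK) => // w.
by rewrite inE => /eqP ->; rewrite int_row0 subr0.
Qed.

Lemma int_row_neq_opp d (w : 'rV[int]_d) : w != 0 -> w != - w.
Proof.
apply: contraNN => /eqP wN; apply/eqP/rowP => i.
have wNi : w 0 i = - w 0 i by rewrite {1}wN mxE.
by rewrite [RHS]mxE; move: (w 0 i) wNi => z; lia.
Qed.

(** Otherwise [c], [b], [-b], [a], [-a] would be five distinct collision vectors. *)
Lemma mem_two_opp_pairs (R : realType) (d : nat) (K : set 'rV[R]_d) a b c :
  collision_vectors K #<= `I_4 -> a != 0 -> b != 0 -> c != 0 ->
  collides K a -> collides K b -> collides K c ->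
  b \notin [:: a; - a] -> c \in [:: a; - a; b; - b].
Proof.
move=> hcollision a0 b0 c0 Sa Sb Sc; rewrite !inE negb_or => /andP[ba baN].
apply: contraT; rewrite !negb_or => /and4P[ca caN cb cbN].
pose s := [:: c; b; - b; a; - a].
have us : uniq (map (@int_row R d) s).
  rewrite (map_inj_uniq (@int_row_inj R d)) /= !inE !negb_or.
  by rewrite cb cbN ca caN !int_row_neq_opp // ba baN eqr_oppLR baN eqr_opp ba.
suff /(card_le_II_uniq hcollision us) :
    forall z, z \in map (@int_row R d) s -> collision_vectors K z by [].
have SN w : w != 0 -> collides K w ->
    collision_vectors K (int_row R w) /\ collision_vectors K (int_row R (- w)).
  move=> w0 Sw; split; first exact: collidesP.
  by apply: collidesP; [rewrite oppr_eq0|apply: collidesN].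
move=> _ /mapP[w + ->]; rewrite !inE.
by case/or4P=> [/eqP->|/eqP->|/eqP->|/orP[]/eqP->]; have [Ha Na] := SN a a0 Sa;
  have [Hb Nb] := SN b b0 Sb; have [Hc Nc] := SN c c0 Sc; assumption.
Qed.

Lemma not_dvd_coord d (n : int) (w : 'rV[int]_d) :
  (forall v, w != n *: v) -> exists j, ~~ (n %| w 0%R j)%Z.
Proof.
move=> wn; apply: contrapT => /forallNP nw.
have /eqP[] := wn (\row_j (w 0%R j %/ n)%Z); apply/rowP => j; rewrite !mxE.
by rewrite mulrC divzK //; apply: contraT => /nw.
Qed.

(** * The two cases for at most four collision vectors *)

Section four_collisions.
Variables (R : realType) (d m : nat) (K : set 'rV[R]_d).
Hypothesis hK : convex_body K.
Hypothesis htiling : fold_tiling m (lattice_translates K).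
Hypothesis hcollision : collision_vectors K #<= `I_4.

Let ker_mod_has_lattice_tiling (a : 'I_d -> int) j : a j = 1 -> (0 < m)%N ->
  collision_free K (ker_mod a m) -> has_lattice_tiling K.
Proof.
move=> aj m0 Sa; exists (@int_row R d @` ker_mod a m); split.
- exact: (is_lattice_ker_mod R aj).
- by move=> _ [w _ <-]; apply/integer_pointsP; exists w.
- exact: (ker_mod_tiling hK htiling m0 Sa).
Qed.

Lemma collision_double_tiling (w : 'rV[int]_d) :
  w != 0 -> collides K (w *+ 2) -> has_lattice_tiling K.
Proof.
move=> w0 Sw2.
have Sw : collides K w.
  by case: Sw2 => x Kx Kxw; exists x; [exact: Kx|exact: (interior_between hK Kx Kxw)].
have mul_neq0 (v : 'rV[int]_d) n : v != 0 -> v *+ n.+1 != 0.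
  apply: contraNN => /eqP/rowP vn; apply/eqP/rowP => i.
  by have /eqP := vn i; rewrite mulmxnE !mxE mulrn_eq0 => /eqP.
have ww2 : w *+ 2 \notin [:: w; - w].
  rewrite !inE negb_or mulr2n -subr_eq0 addrK w0 -subr_eq0 opprK -mulr2n -mulrSr.
  exact: mul_neq0.
have Ssub v : v != 0 -> collides K v -> v \in [:: w; - w; w *+ 2; - (w *+ 2)].
  by move=> v0 Sv; apply: (mem_two_opp_pairs hcollision) => //;
    exact: mul_neq0.
have [j wj] : exists j, ~~ (3 %| w 0%R j)%Z.
  (* If [w = 3v], then [v] collides too and must be one of [3v], [-3v], [6v], [-6v], which is
     impossible for nonzero [v]. *)
  apply: not_dvd_coord => v; apply/negP => /eqP wv.
  have wv3 : w = v *+ 3 by rewrite wv -scaler_nat.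
  have v0 : v != 0 by apply: contraNN w0 => /eqP v0; rewrite wv3 v0 mul0rn.
  have Sv : collides K v.
    case: Sw => x Kx Kxw; exists x; first exact: Kx.
    by apply: (interior_between (n := 2) hK Kx); rewrite -wv3.
  have vS := Ssub v v0 Sv; move/eqP: v0; apply; apply/rowP => i.
  have wvi : w 0 i = 3 * v 0 i by rewrite wv mxE.
  move: vS; rewrite !inE => /or4P[] /eqP /rowP /(_ i);
    rewrite ?mxE ?mulmxnE; move: (v 0 i) (w 0 i) wvi => y z; clear; lia.
(* As 3 does not divide [w_j], it divides none of the [j]-th coordinates of [w], [-w], [2w],
   [-2w]. *)
have S3 : collision_free K (ker_mod (fun i => (i == j)%:R) 3).
  move=> v v0 vj Sv; move: vj; rewrite /ker_mod /= dot_delta; apply/negP.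
  by move: (Ssub v v0 Sv); rewrite !inE => /or4P[] /eqP ->;
    rewrite ?mxE ?mulmxnE; move: (w 0 j) wj => z; clear; lia.
(* The index bounds [m] above by 3; the common interior point of the translates by [0], [w], [2w]
   bounds it below. *)
have m3 : m = 3.
  apply/eqP; rewrite eqn_leq (multiplicity_le_index hK htiling _ S3) //=.
  have [pK _] := htiling; have [x Kx Kx2] := Sw2.
  apply: (@lattice_packing_size _ _ _ _ hK x [:: 0; w; w *+ 2] pK).
    rewrite /= !inE !negb_or eq_sym w0 eq_sym mul_neq0 //= andbT.
    by move: ww2; rewrite !inE negb_or eq_sym => /andP[].
  move=> v; rewrite !inE => /or3P[] /eqP ->.
  - by rewrite int_row0 subr0.
  - exact: (interior_between hK Kx Kx2).
  - exact: Kx2.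
apply: (@ker_mod_has_lattice_tiling (fun i => (i == j)%:R) j); rewrite ?m3 //.
by rewrite eqxx.
Qed.

Lemma no_collision_double_tiling :
  (forall w : 'rV[int]_d, w != 0 -> ~ collides K (w *+ 2)) -> has_lattice_tiling K.
Proof.
move=> S2.
have m0 : (0 < m)%N by apply: (multiplicity_gt0 hK); case: htiling.
have [m1|m1] := eqVneq m 1%N; first exact: (one_fold_tiling_integer_points htiling m1).
have [[a [a0 Sa]]|noS] := pselect (exists a, a != 0 /\ collides K a); last first.
  (* Without collisions all of [Z^d], the kernel of the zero form modulo 1, is collision-free, so
     [m <= 1], contrary to [m1]. *)
  have /(multiplicity_le_index hK htiling) : collision_free K (ker_mod (fun=> 0) 1).
    by move=> w w0 _ Sw; apply: noS; exists w.
  by move=> /(_ isT) mle1; case: ltngtP m1 mle1; rewrite ?ltnS; lia.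
have [b [b0 Sb Ssub]] : exists b, [/\ b != 0, collides K b &
    forall c, c != 0 -> collides K c -> c \in [:: a; - a; b; - b]].
  have [[b [b0 Sb ba]]|nob] := pselect (exists b,
      [/\ b != 0, collides K b & b \notin [:: a; - a]]).
    exists b; split; [exact: b0|exact: Sb|move=> c c0 Sc].
    exact: (mem_two_opp_pairs hcollision a0 b0 c0 Sa Sb Sc ba).
  (* With only one opposite pair, [b = a] serves as a degenerate second pair. *)
  exists a; split; [exact: a0|exact: Sa|move=> c c0 Sc; apply: contraT => ca].
  case: nob; exists c; split; [exact: c0|exact: Sc|apply: contraNN ca].
  by rewrite !inE => /orP[] ->; rewrite ?orbT.
have odd_coord w : w != 0 -> collides K w -> exists j, ~~ (2 %| w 0%R j)%Z.
  move=> w0 Sw; apply: not_dvd_coord => v; apply/negP => /eqP wv.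
  have wv2 : w = v *+ 2 by rewrite wv -scaler_nat.
  apply: (S2 v); last by rewrite -wv2.
  by apply: contraNN w0 => /eqP v0; rewrite wv2 v0 mul0rn.
have [e [j [ej ea eb]]] : exists (e : 'I_d -> int) j,
    [/\ e j = 1, ~~ (2 %| dot e a)%Z & ~~ (2 %| dot e b)%Z].
  have [j aj] := odd_coord a a0 Sa; have [k bk] := odd_coord b b0 Sb.
  have [bj|bj] := boolP (2 %| b 0%R j)%Z; last first.
    by exists (fun i => (i == j)%:R), j; rewrite !dot_delta eqxx.
  have [ak|ak] := boolP (2 %| a 0%R k)%Z; last first.
    by exists (fun i => (i == k)%:R), k; rewrite !dot_delta eqxx.
  (* Here [a_j] and [b_k] are odd while [a_k] and [b_j] are even, so both sums are odd. Also [j] and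
     [k] differ, which makes the coefficient at [j] equal to 1. *)
  exists (fun i => (i == j)%:R + (i == k)%:R), j; rewrite !dot_deltaD eqxx.
  have jk : j != k by apply: contraNneq aj => ->.
  rewrite (negPf jk) addr0; split => //.
    by rewrite rpredDr.
  by rewrite rpredDl.
have Se : collision_free K (ker_mod e 2).
  move=> c c0 ec Sc; have dotN v : dot e (- v) = - dot e v.
    by rewrite -sub0r dotB /dot big1 ?sub0r // => i _; rewrite mxE mulr0.
  move: ec (Ssub c c0 Sc); rewrite /ker_mod /= !inE => ec.
  by case/or4P=> /eqP cE; move: ec ea eb; rewrite cE ?dotN ?rpredN => ->.
(* The index gives [m <= 2], and the values 0 and 1 are already excluded. *)
have m2 : m = 2.
  by have := multiplicity_le_index hK htiling (isT : (0 < 2)%N) Se; lia.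
by apply: (ker_mod_has_lattice_tiling ej m0); rewrite m2.
Qed.

End four_collisions.

Theorem corollary3 (R : realType) (d m : nat) (K : set 'rV[R]_d)
    (hK : convex_body K)
    (htiling : fold_tiling m (lattice_translates K))
    (hcollision : collision_vectors K #<= `I_4) :
  exists L : set 'rV[R]_d,
    [/\ is_lattice L,
        L `<=` @integer_points R d &
        fold_tiling 1%N (translates K L)].
Proof.
have [[w [w0 Sw2]]|noS2] := pselect (exists w, w != 0 /\ collides K (w *+ 2)).
  exact: (collision_double_tiling hK htiling hcollision w0 Sw2).
apply: (no_collision_double_tiling hK htiling hcollision) => w w0 Sw2.
by apply: noS2; exists w.
Qed.
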